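(* Let $G$ be an algebraic group over a field $k$ and $H$ a closed subgroup of $G$. A $G$-module $M$ is $(G,H)$-injective if and only if $M$ is a direct summand (as a $G$-module) of $\mathrm{ind}_H^G(N)$ for some $H$-module $N$.
   Context: Modules are rational modules. An exact sequence of $G$-modules $\cdots\to M_{i-1}\xrightarrow{d_{i-1}}M_i\xrightarrow{d_i}M_{i+1}\to\cdots$ is $(G,H)$-exact if $\mathrm{Ker}(d_i)$ is a direct $H$-module summand of $M_i$ for all $i$. A $G$-module $I$ is $(G,H)$-injective if for every $(G,H)$-exact sequence $0\to M_1\xrightarrow{d_1}M_2\to M_3\to0$ and every $G$-homomorphism $f:M_1\to I$ there is a $G$-homomorphism $h:M_2\to I$ with $f=h\circ d_1$. The induction functor is $\mathrm{ind}_H^G(N)=(N\otimes k[G])^H$, equivalently $\{f:G\to N \mid f(gh)=h^{-1}f(g)\ \text{for all } g\in G,\ h\in H\}$ (regular maps); it is right adjoint to restriction $\mathrm{res}_H^G$. *)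

(* Defs.v *)
From HB Require Import structures.
From mathcomp Require Import all_boot all_algebra.
From mathcomp Require Import boolp classical_sets.

Set Implicit Arguments.
Unset Strict Implicit.
Unset Printing Implicit Defensive.

Import GRing.Theory.
Local Open Scope ring_scope.
Local Open Scope quotient_scope.

Reserved Notation "M \ox N" (at level 40, left associativity).

Section TensorDef.
Variables (k : comNzRingType) (M N : lmodType k).

Definition bisum (P : lmodType k) (f : M -> N -> P) (s : seq (M * N)) : P :=
  \sum_(p <- s) f p.1 p.2.

(* The tensor product is the set of formal sums of pairs, modulo the relation
   identifying two sums that no bilinear map separates. *)
Definition teq (s t : seq (M * N)) : bool :=
  `[< forall (P : lmodType k) (f : {bilinear M -> N -> P}),
        bisum f s = bisum f t >].

Lemma teq_refl : reflexive teq.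
Proof. by move=> s; apply/asboolP. Qed.

Lemma teq_sym : symmetric teq.
Proof.
by move=> s t; apply/asboolP/asboolP => h P f; rewrite h.
Qed.

Lemma teq_trans : transitive teq.
Proof.
by move=> s t u /asboolP h /asboolP h'; apply/asboolP => P f; rewrite h h'.
Qed.

Canonical teq_equiv := EquivRel teq teq_refl teq_sym teq_trans.

Definition tensor := {eq_quot teq}.
HB.instance Definition _ := Choice.on tensor.

Definition tlift (P : lmodType k) (f : {bilinear M -> N -> P}) (t : tensor) : P :=
  bisum f (repr t).

Lemma tlift_pi (P : lmodType k) (f : {bilinear M -> N -> P}) s :
  tlift f (\pi_tensor s) = bisum f s.
Proof.
by rewrite /tlift; have /eqmodP/asboolP := reprK (\pi_tensor s); apply.
Qed.

Lemma tlift_inj (t u : tensor) :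
  (forall (P : lmodType k) (f : {bilinear M -> N -> P}), tlift f t = tlift f u) ->
  t = u.
Proof.
move=> h; rewrite -[t]reprK -[u]reprK; apply/eqmodP/asboolP => P f; exact: h.
Qed.

Definition tadd (t u : tensor) : tensor := \pi_tensor (repr t ++ repr u).
Definition tzero : tensor := \pi_tensor [::].
Definition tscale (a : k) (t : tensor) : tensor :=
  \pi_tensor [seq (a *: p.1, p.2) | p <- repr t].
Definition topp (t : tensor) : tensor := tscale (-1) t.

Section Lift.
Variables (P : lmodType k) (f : {bilinear M -> N -> P}).

Lemma tlift_tadd t u : tlift f (tadd t u) = tlift f t + tlift f u.
Proof. by rewrite tlift_pi /bisum big_cat. Qed.

Lemma tlift_tzero : tlift f tzero = 0.
Proof. by rewrite tlift_pi /bisum big_nil. Qed.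

Lemma tlift_tscale a t : tlift f (tscale a t) = a *: tlift f t.
Proof.
rewrite tlift_pi /bisum big_map scaler_sumr.
by apply: eq_bigr => p _; rewrite linearZl_LR.
Qed.

End Lift.

Definition tliftE := (tlift_tadd, tlift_tzero, tlift_tscale).

Lemma taddA : associative tadd.
Proof. by move=> s t u; apply: tlift_inj => P f; rewrite !tliftE addrA. Qed.

Lemma taddC : commutative tadd.
Proof. by move=> s t; apply: tlift_inj => P f; rewrite !tliftE addrC. Qed.

Lemma tadd0 : left_id tzero tadd.
Proof. by move=> s; apply: tlift_inj => P f; rewrite !tliftE add0r. Qed.

Lemma taddN : left_inverse tzero topp tadd.
Proof.
by move=> s; apply: tlift_inj => P f; rewrite !tliftE scaleN1r addNr.
Qed.

HB.instance Definition _ := GRing.isZmodule.Build tensor taddA taddC tadd0 taddN.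

Lemma tscaleA a b t : tscale a (tscale b t) = tscale (a * b) t.
Proof. by apply: tlift_inj => P f; rewrite !tliftE scalerA. Qed.

Lemma tscale1 : left_id 1 tscale.
Proof. by move=> t; apply: tlift_inj => P f; rewrite !tliftE scale1r. Qed.

Lemma tscaleDr : right_distributive tscale +%R.
Proof. by move=> a s t; apply: tlift_inj => P f; rewrite !tliftE scalerDr. Qed.

Lemma tscaleDl t : {morph tscale^~ t : a b / a + b}.
Proof. by move=> a b; apply: tlift_inj => P f; rewrite !tliftE scalerDl. Qed.

HB.instance Definition _ := GRing.Zmodule_isLmodule.Build k tensor
  tscaleA tscale1 tscaleDr tscaleDl.

Lemma tlift_linear (P : lmodType k) (f : {bilinear M -> N -> P}) :
  linear (tlift f).
Proof. by move=> a s t; rewrite tlift_tadd tlift_tscale. Qed.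

HB.instance Definition _ (P : lmodType k) (f : {bilinear M -> N -> P}) :=
  GRing.isLinear.Build k tensor P *:%R (tlift f) (tlift_linear f).

Definition tens (m : M) (n : N) : tensor := \pi_tensor [:: (m, n)].

Lemma tlift_tens (P : lmodType k) (f : {bilinear M -> N -> P}) m n :
  tlift f (tens m n) = f m n.
Proof. by rewrite tlift_pi /bisum big_seq1. Qed.

Lemma tens_bilinear : bilinear_for *:%R *:%R tens.
Proof.
split=> [n a x y|m a x y]; apply: tlift_inj => P f;
  rewrite tlift_tadd tlift_tscale !tlift_tens.
- by rewrite linearDl linearZl_LR.
- by rewrite linearDr linearZr_LR.
Qed.

HB.instance Definition _ :=
  bilinear_isBilinear.Build k M N tensor *:%R *:%R tens tens_bilinear.

Lemma tens_sum (t : tensor) : t = \sum_(p <- repr t) tens p.1 p.2.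
Proof.
apply: tlift_inj => P f; rewrite linear_sum /=.
by rewrite /tlift /bisum; apply: eq_bigr => p _; rewrite -tlift_tens.
Qed.

Lemma tens_ind (Q : tensor -> Prop) :
  (forall m n, Q (tens m n)) -> (forall s t, Q s -> Q t -> Q (s + t)) ->
  forall t, Q t.
Proof.
move=> Qt QD t; rewrite (tens_sum t); elim: (repr t) => [|p s IH].
  by rewrite big_nil -(linear0l tens 0).
by rewrite big_cons; apply: QD.
Qed.

End TensorDef.

Arguments tens {k M N} m n.
Arguments tensor {k} (M N)%_type_scope.

Notation "M \ox N" := (tensor M N) : type_scope.
Notation "m \ox n" := (tens m n) : ring_scope.

Section TensorTheory.
Variables (k : comNzRingType) (M N : lmodType k).
Implicit Types (m : M) (n : N).

Lemma tensDl m m' n : (m + m') \ox n = m \ox n + m' \ox n.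
Proof. exact: linearDl. Qed.
Lemma tensDr m n n' : m \ox (n + n') = m \ox n + m \ox n'.
Proof. exact: linearDr. Qed.
Lemma tensZl a m n : (a *: m) \ox n = a *: (m \ox n).
Proof. exact: linearZl_LR. Qed.
Lemma tensZr a m n : m \ox (a *: n) = a *: (m \ox n).
Proof. exact: linearZr_LR. Qed.
Lemma tens0l n : (0 : M) \ox n = 0.
Proof. exact: linear0l. Qed.
Lemma tens0r m : m \ox (0 : N) = 0.
Proof. exact: linear0r. Qed.

Lemma tens_ext (P : lmodType k) (f g : {linear (M \ox N)%type -> P}) :
  (forall m n, f (m \ox n) = g (m \ox n)) -> f =1 g.
Proof.
move=> fg t; elim/tens_ind: t => [m n|s t IHs IHt]; first exact: fg.
by rewrite !linearD IHs IHt.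
Qed.

Definition tensr n : M -> M \ox N := fun m => m \ox n.

Lemma tensrE n m : tensr n m = m \ox n.
Proof. by []. Qed.

Lemma tensr_linear n : linear (tensr n).
Proof. by move=> a x y; rewrite /tensr tensDl tensZl. Qed.

HB.instance Definition _ n :=
  GRing.isLinear.Build k M (M \ox N)%type *:%R (tensr n) (tensr_linear n).

End TensorTheory.

Section TensorMap.
Variables (k : comNzRingType) (M N M' N' : lmodType k).
Variables (f : {linear M -> M'}) (g : {linear N -> N'}).

Definition tmap_bil (m : M) (n : N) : M' \ox N' := f m \ox g n.

Lemma tmap_bilinear : bilinear_for *:%R *:%R tmap_bil.
Proof.
by split=> [n a x y|m a x y]; rewrite /tmap_bil linearP ?tensDl ?tensZl ?tensDr ?tensZr.
Qed.

HB.instance Definition _ :=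
  bilinear_isBilinear.Build k M N (M' \ox N')%type *:%R *:%R tmap_bil tmap_bilinear.

Definition tmap : M \ox N -> M' \ox N' := tlift tmap_bil.

HB.instance Definition _ := GRing.Linear.on tmap.

Lemma tmapE m n : tmap (m \ox n) = f m \ox g n.
Proof. by rewrite /tmap tlift_tens. Qed.

End TensorMap.

Section TensorSwap.
Variables (k : comNzRingType) (M N : lmodType k).

Definition tswap_bil (m : M) (n : N) : N \ox M := n \ox m.

Lemma tswap_bilinear : bilinear_for *:%R *:%R tswap_bil.
Proof.
by split=> [n a x y|m a x y]; rewrite /tswap_bil ?tensDl ?tensZl ?tensDr ?tensZr.
Qed.

HB.instance Definition _ :=
  bilinear_isBilinear.Build k M N (N \ox M)%type *:%R *:%R tswap_bil tswap_bilinear.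

Definition tswap : M \ox N -> N \ox M := tlift tswap_bil.

HB.instance Definition _ := GRing.Linear.on tswap.

Lemma tswapE m n : tswap (m \ox n) = n \ox m.
Proof. by rewrite /tswap tlift_tens. Qed.

End TensorSwap.
Arguments tswap {k M N}.

Section TensorAssoc.
Variables (k : comNzRingType) (M N P : lmodType k).

Definition tassoc_bil (t : M \ox N) (p : P) : M \ox (N \ox P) :=
  tmap idfun (tensr p) t.

Lemma tassoc_bilinear : bilinear_for *:%R *:%R tassoc_bil.
Proof.
split=> [p a s t|t a p q]; rewrite /tassoc_bil; first by rewrite linearP.
elim/tens_ind: t => [m n|s t IHs IHt].
  by rewrite !tmapE /= !tensrE tensDr tensZr tensDr tensZr.
by rewrite !linearD /= IHs IHt scalerDr addrACA.
Qed.

HB.instance Definition _ := bilinear_isBilinear.Build k (M \ox N)%type P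
  (M \ox (N \ox P))%type *:%R *:%R tassoc_bil tassoc_bilinear.

Definition tassoc : (M \ox N) \ox P -> M \ox (N \ox P) := tlift tassoc_bil.

HB.instance Definition _ := GRing.Linear.on tassoc.

Lemma tassocE m n p : tassoc ((m \ox n) \ox p) = m \ox (n \ox p).
Proof. by rewrite /tassoc tlift_tens /= /tassoc_bil tmapE. Qed.

End TensorAssoc.
Arguments tassoc {k M N P}.

Section TensorMiddle.
Variables (k : comNzRingType) (M N P Q : lmodType k).

Definition tmid_bil (s : M \ox N) (t : P \ox Q) : (M \ox P) \ox (N \ox Q) :=
  \sum_(u <- repr t) tmap (tensr u.1) (tensr u.2) s.

Section Aux.
Variable s : M \ox N.
Definition tmid_aux (p : P) (q : Q) : (M \ox P) \ox (N \ox Q) :=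
  tmap (tensr p) (tensr q) s.
Lemma tmid_aux_bilinear : bilinear_for *:%R *:%R tmid_aux.
Proof.
split=> [q a p p'|p a q q']; rewrite /tmid_aux; elim/tens_ind: s => [m n|x y IHx IHy].
- by rewrite !tmapE /= !tensrE tensDr tensZr tensDl tensZl.
- by rewrite !linearD /= IHx IHy scalerDr addrACA.
- by rewrite !tmapE /= !tensrE [in LHS]tensDr [in LHS]tensZr tensDr tensZr.
- by rewrite !linearD /= IHx IHy scalerDr addrACA.
Qed.
HB.instance Definition _ := bilinear_isBilinear.Build k P Q
  ((M \ox P) \ox (N \ox Q))%type *:%R *:%R tmid_aux tmid_aux_bilinear.
End Aux.

Lemma tmid_bilE s t : tmid_bil s t = tlift (tmid_aux s) t.
Proof. by []. Qed.

Lemma tmid_bilinear : bilinear_for *:%R *:%R tmid_bil.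
Proof.
split=> [t a x y|s a x y].
  rewrite /tmid_bil /= scaler_sumr -big_split /=.
  by apply: eq_bigr => u _; rewrite linearP.
by rewrite !tmid_bilE linearP.
Qed.

HB.instance Definition _ := bilinear_isBilinear.Build k (M \ox N)%type (P \ox Q)%type
  ((M \ox P) \ox (N \ox Q))%type *:%R *:%R tmid_bil tmid_bilinear.

Definition tmid : (M \ox N) \ox (P \ox Q) -> (M \ox P) \ox (N \ox Q) :=
  tlift tmid_bil.

HB.instance Definition _ := GRing.Linear.on tmid.

Lemma tmidE m n p q :
  tmid ((m \ox n) \ox (p \ox q)) = (m \ox p) \ox (n \ox q).
Proof. by rewrite /tmid tlift_tens /= tmid_bilE tlift_tens /= /tmid_aux tmapE. Qed.

End TensorMiddle.
Arguments tmid {k M N P Q}.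

Section Contraction.
Variables (k : comNzRingType) (M N : lmodType k) (e : {linear N -> k^o}).

Definition tcontr_bil (m : M) (n : N) : M := (e n : k) *: m.

Lemma tcontr_bilinear : bilinear_for *:%R *:%R tcontr_bil.
Proof.
split=> [n a x y|m a x y]; rewrite /tcontr_bil /=.
  by rewrite scalerDr !scalerA mulrC.
by rewrite linearP scalerDl scalerA.
Qed.

HB.instance Definition _ :=
  bilinear_isBilinear.Build k M N M *:%R *:%R tcontr_bil tcontr_bilinear.

Definition tcontr : M \ox N -> M := tlift tcontr_bil.

HB.instance Definition _ := GRing.Linear.on tcontr.

Lemma tcontrE m n : tcontr (m \ox n) = (e n : k) *: m.
Proof. by rewrite /tcontr tlift_tens. Qed.

End Contraction.

Section TensorMul.
Variables (k : comNzRingType) (A : comAlgType k).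

Definition tprod_bil (a b : A) : A := a * b.

Lemma tprod_bilinear : bilinear_for *:%R *:%R tprod_bil.
Proof.
split=> [b c x y|a c x y]; rewrite /tprod_bil /=.
  by rewrite mulrDl scalerAl.
by rewrite mulrDr scalerAr.
Qed.

HB.instance Definition _ :=
  bilinear_isBilinear.Build k A A A *:%R *:%R tprod_bil tprod_bilinear.

Definition tprod : A \ox A -> A := tlift tprod_bil.

HB.instance Definition _ := GRing.Linear.on tprod.

Lemma tprodE a b : tprod (a \ox b) = a * b.
Proof. by rewrite /tprod tlift_tens. Qed.

Definition tmulm : (A \ox A) \ox (A \ox A) -> A \ox A :=
  tmap tprod tprod \o tmid.

HB.instance Definition _ := GRing.Linear.on tmulm.

Definition tmul (s t : A \ox A) : A \ox A := tmulm (s \ox t).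

Lemma tmulE a b c d : tmul (a \ox b) (c \ox d) = (a * c) \ox (b * d).
Proof. by rewrite /tmul /tmulm /= tmidE tmapE /= !tprodE. Qed.

Lemma tmulA s t u : tmul (tmul s t) u = tmul s (tmul t u).
Proof.
rewrite /tmul.
elim/tens_ind: s => [a a'|x y IHx IHy].
  elim/tens_ind: t => [b b'|x y IHx IHy].
    elim/tens_ind: u => [c c'|x y IHx IHy].
      by rewrite -!/(tmul _ _) !tmulE !mulrA.
    by rewrite !(tensDr, linearD) /= IHx IHy.
  by rewrite !(tensDl, tensDr, linearD) /= IHx IHy.
by rewrite !(tensDl, linearD) /= IHx IHy.
Qed.

Lemma tmulr1 s : tmul s (1 \ox 1) = s.
Proof.
elim/tens_ind: s => [a a'|x y IHx IHy]; first by rewrite tmulE !mulr1.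
by rewrite /tmul tensDl linearD /= -!/(tmul _ _) IHx IHy.
Qed.

Lemma tmul1r s : tmul (1 \ox 1) s = s.
Proof.
elim/tens_ind: s => [a a'|x y IHx IHy]; first by rewrite tmulE !mul1r.
by rewrite /tmul tensDr linearD /= -!/(tmul _ _) IHx IHy.
Qed.

End TensorMul.
Arguments tprod {k A}.
Arguments tmulm {k A}.
Arguments tmul {k A}.

Section TensorNaturality.
Variable k : comNzRingType.
Implicit Types M N P : lmodType k.

Lemma tmap_eq M N M' N' (f f' : {linear M -> M'}) (g g' : {linear N -> N'}) :
  f =1 f' -> g =1 g' -> tmap f g =1 tmap f' g'.
Proof.
move=> ff' gg'; apply: tens_ext => m n /=; rewrite !tmapE/=.
by rewrite ff' gg'.
Qed.

Lemma tmap_comp M N M' N' M'' N'' (f : {linear M' -> M''})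
    (g : {linear N' -> N''}) (f' : {linear M -> M'}) (g' : {linear N -> N'}) t :
  tmap f g (tmap f' g' t) = tmap (f \o f') (g \o g') t.
Proof.
move: t; apply: (tens_ext (f := tmap f g \o tmap f' g')) => m n /=.
by rewrite !tmapE /=.
Qed.

Lemma tmap_id M N (t : M \ox N) : tmap idfun idfun t = t.
Proof.
by elim/tens_ind: t => [m n|s t IHs IHt]; rewrite ?tmapE // linearD /= IHs IHt.
Qed.

Lemma tassoc_nat M N P M' N' P' (f : {linear M -> M'}) (g : {linear N -> N'})
    (h : {linear P -> P'}) t :
  tassoc (tmap (tmap f g) h t) = tmap f (tmap g h) (tassoc t).
Proof.
elim/tens_ind: t => [t p|s t IHs IHt]; last by rewrite !linearD /= IHs IHt.
elim/tens_ind: t => [m n|s t IHs IHt]; first by rewrite !(tmapE, tassocE) /= !tmapE /= tassocE.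
by rewrite !(tensDl, linearD) /= IHs IHt.
Qed.

(* built from tmid by inserting a trivial factor k *)
Definition tswapr M N P : (M \ox N) \ox P -> (M \ox P) \ox N :=
  tmap idfun (tcontr idfun) \o tmid \o tmap idfun (tensr (1 : k^o)).

HB.instance Definition _ M N P := GRing.Linear.on (@tswapr M N P).

Lemma tswaprE M N P (m : M) (n : N) (p : P) :
  tswapr ((m \ox n) \ox p) = (m \ox p) \ox n.
Proof. by rewrite /tswapr /= tmapE /= tensrE tmidE tmapE /= tcontrE scale1r. Qed.

Definition tassoci M N P : M \ox (N \ox P) -> (M \ox N) \ox P :=
  tmap idfun (tcontr idfun \o tswap) \o tmid
    \o tmap (tensr (1 : k^o)) idfun.

HB.instance Definition _ M N P := GRing.Linear.on (@tassoci M N P).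

Lemma tassociE M N P (m : M) (n : N) (p : P) :
  tassoci (m \ox (n \ox p)) = (m \ox n) \ox p.
Proof.
by rewrite /tassoci /= tmapE /= tensrE tmidE tmapE /= tswapE tcontrE scale1r.
Qed.

Lemma tassocK M N P : cancel (@tassoc k M N P) (@tassoci M N P).
Proof.
elim/tens_ind => [t p|s t IHs IHt]; last by rewrite !linearD /= IHs IHt.
elim/tens_ind: t => [m n|s t IHs IHt]; first by rewrite tassocE tassociE.
by rewrite !(tensDl, linearD) /= IHs IHt.
Qed.

Lemma tassociK M N P : cancel (@tassoci M N P) (@tassoc k M N P).
Proof.
elim/tens_ind => [m t|s t IHs IHt]; last by rewrite !linearD /= IHs IHt.
elim/tens_ind: t => [n p|s t IHs IHt]; first by rewrite tassociE tassocE.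
by rewrite !(tensDr, linearD) /= IHs IHt.
Qed.

End TensorNaturality.
Arguments tswapr {k M N P}.
Arguments tassoci {k M N P}.

(* An algebraic group is an affine group scheme of finite type, given by its
   coordinate algebra. *)
Record alg_group (k : fieldType) := AlgGroup {
  coord : comAlgType k;
  comul : {linear coord -> (coord \ox coord)%type};
  counit : {lrmorphism coord -> k^o};
  antipode : {lrmorphism coord -> coord};
  comul1 : comul 1 = 1 \ox 1;
  comulM : forall a b, comul (a * b) = tmul (comul a) (comul b);
  comulA : forall a,
    tassoc (tmap comul idfun (comul a)) = tmap idfun comul (comul a);
  counitr : forall a, tcontr counit (comul a) = a;
  counitl : forall a, tcontr counit (tswap (comul a)) = a;
  antipodel : forall a, tprod (tmap antipode idfun (comul a)) = counit a *: 1;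
  antipoder : forall a, tprod (tmap idfun antipode (comul a)) = counit a *: 1;
  coord_fg : exists gens : seq coord, forall S : {pred coord},
    GRing.subalg_closed S -> {subset gens <= S} -> forall a, a \in S
}.
Arguments comul {k} _.
Arguments counit {k} _.
Arguments antipode {k} _.

(* A closed subgroup is a closed immersion of group schemes: a surjective
   homomorphism of Hopf algebras out of the coordinate algebra. *)
Record closed_subgroup (k : fieldType) (G : alg_group k) := ClosedSubgroup {
  subgrp :> alg_group k;
  cres : {lrmorphism coord G -> coord subgrp};
  cres_surj : forall b, exists a, cres a = b;
  cres_comul : forall a, comul subgrp (cres a) = tmap cres cres (comul G a);
  cres_counit : forall a, counit subgrp (cres a) = counit G a
}.
Arguments cres {k G} _.

Section Antipode.
Variables (k : fieldType) (G : alg_group k).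
Local Notation A := (coord G).
Local Notation Delta := (comul G).
Local Notation S := (antipode G).

Definition unitm (a : A) : A := (counit G a : k) *: 1.

Lemma unitm_linear : linear unitm.
Proof. by move=> a x y; rewrite /unitm linearP scalerDl scalerA. Qed.

HB.instance Definition _ :=
  GRing.isLinear.Build k A A *:%R unitm unitm_linear.

Lemma antipode_counit a : counit G (S a) = counit G a.
Proof.
have h (t : A \ox A) :
    counit G (tprod (tmap S idfun t)) = counit G (S (tcontr (counit G) t)).
  elim/tens_ind: t => [x y|s t IHs IHt]; last by rewrite !linearD /= IHs IHt.
  rewrite tmapE /= tprodE tcontrE rmorphM linearZ /= linearZ /=.
  exact: mulrC.
have := h (Delta a); rewrite antipodel counitr linearZ /= rmorph1 => <-.
by rewrite /GRing.scale /= mulr1.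
Qed.

Definition conv (f g : {linear A -> (A \ox A)%type}) := tmulm \o tmap f g \o Delta.
HB.instance Definition _ f g := GRing.Linear.on (conv f g).

Lemma convE f g a : conv f g a = tmulm (tmap f g (Delta a)).
Proof. by []. Qed.

Definition conv_unit (a : A) : A \ox A := (counit G a : k) *: (1 \ox 1).
Lemma conv_unit_linear : linear conv_unit.
Proof. by move=> a x y; rewrite /conv_unit linearP scalerDl scalerA. Qed.
HB.instance Definition _ :=
  GRing.isLinear.Build k A (A \ox A)%type *:%R conv_unit conv_unit_linear.

Lemma convA f g h a : conv (conv f g) h a = conv f (conv g h) a.
Proof.
have hl (t : (A \ox A) \ox A) :
    tmulm (tmap (tmulm \o tmap f g) h t) = tmulm (tmap f (tmulm \o tmap g h) (tassoc t)).
  elim/tens_ind: t => [t z|s t IHs IHt]; last by rewrite !linearD /= IHs IHt.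
  elim/tens_ind: t => [x y|s t IHs IHt].
    by rewrite tassocE !tmapE /= !tmapE -!/(tmul _ _) tmulA.
  by rewrite !(tensDl, linearD) /= IHs IHt.
have e1 : tmap (conv f g) h (Delta a) =
    tmap (tmulm \o tmap f g) h (tmap Delta idfun (Delta a)).
  by rewrite tmap_comp; apply: tmap_eq => x.
have e2 : tmap f (conv g h) (Delta a) =
    tmap f (tmulm \o tmap g h) (tmap idfun Delta (Delta a)).
  by rewrite tmap_comp; apply: tmap_eq => x.
by rewrite convE e1 hl comulA -e2.
Qed.

Lemma convr1 f a : conv f conv_unit a = f a.
Proof.
rewrite !convE -[in RHS](counitr a); elim/tens_ind: (Delta a) => [x y|s t IHs IHt].
  by rewrite tmapE /= tcontrE linearZ /= tensZr linearZ /= -/(tmul _ _) tmulr1.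
by rewrite !linearD /= IHs IHt.
Qed.

Lemma conv1r f a : conv conv_unit f a = f a.
Proof.
rewrite !convE -[in RHS](counitl a); elim/tens_ind: (Delta a) => [x y|s t IHs IHt].
  by rewrite tmapE /= tswapE tcontrE linearZ /= tensZl linearZ /= -/(tmul _ _) tmul1r.
by rewrite !linearD /= IHs IHt.
Qed.

Definition comulS := Delta \o S.
HB.instance Definition _ := GRing.Linear.on comulS.
Definition Scomul := tswap \o tmap S S \o Delta.
HB.instance Definition _ := GRing.Linear.on Scomul.

Lemma conv_comulS a : conv comulS Delta a = conv_unit a.
Proof.
have h (t : A \ox A) : tmulm (tmap comulS Delta t) = Delta (tprod (tmap S idfun t)).
  elim/tens_ind: t => [x y|s t IHs IHt]; last by rewrite !linearD /= IHs IHt.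
  by rewrite !tmapE /= tprodE -/(tmul _ _) comulM.
by rewrite !convE h antipodel linearZ /= comul1.
Qed.

Lemma conv_Scomul_aux p b :
  tmulm (tmap idfun Scomul (tassoci (p \ox Delta b))) = (p * S b) \ox 1.
Proof.
pose X (t : A \ox (A \ox A)) : A \ox A :=
  tmap (tprod \o tmap idfun S) (p \*o S) (tassoci t).
have hX (w : A \ox A) : tmulm (tmap idfun Scomul (tassoci (p \ox w))) =
    tswap (X (tmap idfun Delta w)).
  elim/tens_ind: w => [x y|s t IHs IHt]; last by rewrite /X !(tensDr, linearD) /= IHs IHt.
  rewrite tassociE !tmapE /= /Scomul /=.
  elim/tens_ind: (Delta y) => [y1 y2|s t IHs IHt].
    by rewrite /X tassociE !tmapE /= tmapE tswapE -/(tmul _ _) tmulE tprodE tswapE.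
  by rewrite /X !(tensDr, linearD) /= IHs IHt.
rewrite hX -comulA /X tassocK tmap_comp -[in RHS](counitl b).
have -> : tmap (tprod \o tmap idfun S \o Delta) (p \*o S \o idfun) (Delta b) =
  tmap unitm (p \*o S) (Delta b).
  by apply: tmap_eq => // x /=; rewrite antipoder.
elim/tens_ind: (Delta b) => [x y|s t IHs IHt].
  rewrite tmapE /= tswapE tswapE tcontrE tensZr linearZ /= -tensZl.
  by rewrite -scalerAr.
by rewrite !linearD /= IHs IHt mulrDr tensDl.
Qed.

Lemma conv_Scomul a : conv Delta Scomul a = conv_unit a.
Proof.
have h (t : A \ox A) : tmulm (tmap Delta Scomul t) =
    tmulm (tmap idfun Scomul (tassoci (tassoc (tmap Delta idfun t)))).
  by rewrite tassocK tmap_comp.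
rewrite !convE h comulA.
have h2 (t : A \ox A) : tmulm (tmap idfun Scomul (tassoci (tmap idfun Delta t))) =
    tprod (tmap idfun S t) \ox 1.
  elim/tens_ind: t => [x y|s t IHs IHt]; last by rewrite !linearD /= IHs IHt tensDl.
  by rewrite !tmapE /= conv_Scomul_aux tprodE.
by rewrite h2 antipoder tensZl.
Qed.

Lemma comul_antipode a :
  comul G (antipode G a) =
  tswap (tmap (antipode G) (antipode G) (comul G a)).
Proof.
rewrite -[LHS]/(comulS a) -[RHS]/(Scomul a) -(convr1 comulS) -(conv1r Scomul).
have e1 : tmap comulS conv_unit (Delta a) = tmap comulS (conv Delta Scomul) (Delta a).
  by apply: tmap_eq => // x; symmetry; exact: conv_Scomul.
have e2 : tmap (conv comulS Delta) Scomul (Delta a) = tmap conv_unit Scomul (Delta a).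
  by apply: tmap_eq => // x; exact: conv_comulS.
by rewrite convE e1 -convE -convA convE e2.
Qed.

End Antipode.

Section GModules.
Variables (k : fieldType) (G : alg_group k).

(* Rational modules are comodules over the coordinate algebra. *)
Record gmodule := GModule {
  gmod :> lmodType k;
  coact : {linear gmod -> (gmod \ox coord G)%type};
  coactA : forall m,
    tassoc (tmap coact idfun (coact m)) = tmap idfun (comul G) (coact m);
  coact1 : forall m, tcontr (counit G) (coact m) = m
}.
Arguments coact : clear implicits.

Record ghom (M N : gmodule) := GHom {
  ghom_fun :> {linear M -> N};
  ghomP : forall m, coact N (ghom_fun m) = tmap ghom_fun idfun (coact M m)
}.

Definition subspace (V : lmodType k) (W : set V) : Prop :=
  W 0 /\ forall a x y, W x -> W y -> W (a *: x + y).

Definition stable (M : gmodule) (W : set M) : Prop :=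
  forall w, W w -> exists s : seq (M * coord G),
    (forall p, p \in s -> W p.1) /\ coact M w = \sum_(p <- s) p.1 \ox p.2.

Record gsubmodule (M : gmodule) := GSubmodule {
  gsub_set :> set M;
  gsub_subspace : subspace gsub_set;
  gsub_stable : stable gsub_set
}.

Definition direct_summand (M : gmodule) (W : set M) : Prop :=
  exists U C : gsubmodule M,
    [/\ gsub_set U = W, (U `&` C = [set 0])%classic
      & forall x, exists u c, [/\ gsub_set U u, gsub_set C c & x = u + c]].

Definition invariants (M : gmodule) : set M :=
  [set m | coact M m = m \ox 1]%classic.

Definition triv_coact (V : lmodType k) : V -> V \ox coord G := tensr 1.
HB.instance Definition _ V := GRing.Linear.on (@triv_coact V).

Lemma triv_coactA V m :
  tassoc (tmap (@triv_coact V) idfun (triv_coact m)) =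
  tmap idfun (comul G) (triv_coact m).
Proof. by rewrite {2 3}/triv_coact tensrE !tmapE /= /triv_coact tensrE comul1 tassocE. Qed.

Lemma triv_coact1 V m : tcontr (counit G) (@triv_coact V m) = m.
Proof. by rewrite /triv_coact tensrE tcontrE rmorph1 scale1r. Qed.

Definition triv (V : lmodType k) : gmodule :=
  GModule (@triv_coactA V) (@triv_coact1 V).

Section Tensor.
Variables M N : gmodule.

Definition tens_coact : M \ox N -> (M \ox N) \ox coord G :=
  tmap idfun tprod \o tmid \o tmap (coact M) (coact N).
HB.instance Definition _ := GRing.Linear.on tens_coact.

Lemma tens_coactE m n :
  tens_coact (m \ox n) = tmap idfun tprod (tmid (coact M m \ox coact N n)).
Proof. by rewrite /tens_coact /= tmapE. Qed.

Lemma tens_coactA t :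
  tassoc (tmap tens_coact idfun (tens_coact t)) =
  tmap idfun (comul G) (tens_coact t).
Proof.
pose K (u : M \ox (coord G \ox coord G)) (v : N \ox (coord G \ox coord G)) :=
  tmap idfun tmulm (tmid (u \ox v)).
elim/tens_ind: t => [m n|s t IHs IHt]; last by rewrite !linearD /= IHs IHt.
rewrite tens_coactE.
have hl u v : tassoc (tmap tens_coact idfun (tmap idfun tprod (tmid (u \ox v)))) =
    K (tassoc (tmap (coact M) idfun u)) (tassoc (tmap (coact N) idfun v)).
  rewrite /K.
  elim/tens_ind: u => [x a|u u' IHu IHu'].
    elim/tens_ind: v => [y b|v v' IHv IHv'].
      rewrite tmidE !tmapE /= tprodE tens_coactE.
      elim/tens_ind: (coact M x) => [x0 x1|s t IHs IHt].
        elim/tens_ind: (coact N y) => [y0 y1|s t IHs IHt].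
          by rewrite !tassocE !tmidE !tmapE /= tprodE tassocE -/(tmul _ _) tmulE.
        by rewrite !(tensDr, tensDl, linearD) /= IHs IHt.
      by rewrite !(tensDr, tensDl, linearD) /= IHs IHt.
    by rewrite !(tensDr, linearD) /= IHv IHv'.
  by rewrite !(tensDl, linearD) /= IHu IHu'.
have hr u v : tmap idfun (comul G) (tmap idfun tprod (tmid (u \ox v))) =
    K (tmap idfun (comul G) u) (tmap idfun (comul G) v).
  rewrite /K.
  elim/tens_ind: u => [x a|u u' IHu IHu'].
    elim/tens_ind: v => [y b|v v' IHv IHv'].
      by rewrite !tmidE !tmapE /= tprodE tmidE tmapE /= comulM.
    by rewrite !(tensDr, linearD) /= IHv IHv'.
  by rewrite !(tensDl, linearD) /= IHu IHu'.
by rewrite hl hr !coactA.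
Qed.

Lemma tens_coact1 t : tcontr (counit G) (tens_coact t) = t.
Proof.
elim/tens_ind: t => [m n|s t IHs IHt]; last by rewrite !linearD /= IHs IHt.
rewrite tens_coactE -[in RHS](coact1 m) -[in RHS](coact1 n).
elim/tens_ind: (coact M m) => [x a|s t IHs IHt].
  elim/tens_ind: (coact N n) => [y b|s t IHs IHt].
    rewrite tmidE tmapE /= tprodE !tcontrE rmorphM tensZl tensZr scalerA.
    by [].
  by rewrite !(tensDr, linearD) /= IHs IHt.
by rewrite !(tensDl, linearD) /= IHs IHt.
Qed.

Definition tens_gmodule : gmodule := GModule tens_coactA tens_coact1.

End Tensor.

(* the right regular representation, (g . f)(x) = f (x g) *)
Definition regr : gmodule := GModule (@comulA k G) (@counitr k G).

(* the left regular representation, (g . f)(x) = f (g^-1 x) *)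
Definition regl_coact : coord G -> coord G \ox coord G :=
  tswap \o tmap (antipode G) idfun \o comul G.
HB.instance Definition _ := GRing.Linear.on regl_coact.

Lemma regl_coactA a :
  tassoc (tmap regl_coact idfun (regl_coact a)) =
  tmap idfun (comul G) (regl_coact a).
Proof.
pose S := antipode G.
(* x \ox (y \ox z) |-> z \ox (S y \ox S x) *)
pose K (t : coord G \ox (coord G \ox coord G)) :
    coord G \ox (coord G \ox coord G) :=
  tassoc (tswap (tmap S (tswap \o tmap S idfun) t)).
have hl t : tassoc (tmap regl_coact idfun (tswap (tmap S idfun t))) =
    K (tmap idfun (comul G) t).
  rewrite /K; elim/tens_ind: t => [x y|s t IHs IHt]; last by rewrite !linearD /= IHs IHt.
  by rewrite !tmapE /= !tswapE tmapE.
have hr t : tmap idfun (comul G) (tswap (tmap S idfun t)) =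
    K (tassoc (tmap (comul G) idfun t)).
  rewrite /K; elim/tens_ind: t => [x y|s t IHs IHt]; last by rewrite !linearD /= IHs IHt.
  rewrite !tmapE /= !tswapE tmapE /= comul_antipode.
  elim/tens_ind: (comul G x) => [x1 x2|s t IHs IHt].
    by rewrite tassocE !tmapE /= !tswapE tmapE /= tswapE tassocE.
  by rewrite !(tensDl, tensDr, linearD) /= IHs IHt.
by rewrite /regl_coact /= hl hr comulA.
Qed.

Lemma regl_coact1 a : tcontr (counit G) (regl_coact a) = a.
Proof.
rewrite -[in RHS](counitl a) /regl_coact /=.
elim/tens_ind: (comul G a) => [x y|s t IHs IHt]; last by rewrite !linearD /= IHs IHt.
by rewrite tmapE !tswapE !tcontrE /= antipode_counit.
Qed.

Definition regl : gmodule := GModule regl_coactA regl_coact1.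

End GModules.

Arguments coact {k G}.
Arguments invariants {k G}.

Section Restriction.
Variables (k : fieldType) (G : alg_group k) (H : closed_subgroup G).
Variable M : gmodule G.

Definition restr_coact : M -> M \ox coord H := tmap idfun (cres H) \o coact M.
HB.instance Definition _ := GRing.Linear.on restr_coact.

Lemma restr_coactA m :
  tassoc (tmap restr_coact idfun (restr_coact m)) =
  tmap idfun (comul H) (restr_coact m).
Proof.
have h t : tassoc (tmap restr_coact idfun (tmap idfun (cres H) t)) =
    tmap idfun (tmap (cres H) (cres H)) (tassoc (tmap (coact M) idfun t)).
  have e : tmap restr_coact idfun (tmap idfun (cres H) t) =
      tmap (tmap idfun (cres H)) (cres H) (tmap (coact M) idfun t).
    by rewrite !tmap_comp; apply: tmap_eq => x.
  by rewrite e tassoc_nat.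
rewrite /restr_coact /= h coactA !tmap_comp.
by apply: tmap_eq => // a /=; rewrite cres_comul.
Qed.

Lemma restr_coact1 m : tcontr (counit H) (restr_coact m) = m.
Proof.
rewrite -[in RHS](coact1 m) /restr_coact /=.
elim/tens_ind: (coact M m) => [x a|s t IHs IHt]; last by rewrite !linearD /= IHs IHt.
by rewrite tmapE /= !tcontrE; congr (_ *: _); exact: cres_counit.
Qed.

Definition restr : gmodule H := GModule restr_coactA restr_coact1.

End Restriction.

Section Projection.
Variables (k : fieldType) (V : lmodType k) (W : set V).
Hypothesis sW : subspace W.
Local Open Scope classical_set_scope.

Lemma subspaceD x y : W x -> W y -> W (x + y).
Proof. by move=> Wx Wy; rewrite -[x]scale1r; apply: sW.2. Qed.

Lemma subspaceZ a x : W x -> W (a *: x).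
Proof. by move=> Wx; rewrite -[_ *: _]addr0; apply: sW.2 => //; exact: sW.1. Qed.

Lemma subspaceB x y : W x -> W y -> W (x - y).
Proof. by move=> Wx Wy; rewrite -scaleN1r; apply: subspaceD => //; exact: subspaceZ. Qed.

Lemma complement_exists : exists C : set V, [/\ subspace C,
  (forall x, C x -> W x -> x = 0) & forall x, exists w, W w /\ C (x - w)].
Proof.
pose lin (C : set V) := forall a x y, C x -> C y -> C (a *: x + y).
pose P : set (set V) := [set C | lin C /\ forall x, C x -> W x -> x = 0].
have [|A [[linA AW] maxA]] := @Zorn_bigcup V P.
  move=> F FP totF; split=> [a x y [X FX Xx] [Y FY Yy]|x [X FX Xx]].
    have [XY|YX] := totF _ _ FX FY.
      by exists Y => //; apply: (FP _ FY).1 => //; exact: XY.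
    by exists X => //; apply: (FP _ FX).1 => //; exact: YX.
  exact: (FP _ FX).2.
pose A0 : set V := [set x | A x \/ x = 0].
have linA0 : lin A0.
  move=> a x y [Ax|->] [Ay|->].
  - by left; apply: linA.
  - rewrite addr0; left; rewrite -[_ *: _]addr0.
    have -> : (0 : V) = (-1) *: x + x by rewrite scaleN1r addNr.
    by apply: (linA) => //; apply: (linA).
  - by rewrite scaler0 add0r; left.
  - by rewrite scaler0 add0r; right.
have A0W x : A0 x -> W x -> x = 0 by case=> [/AW|->].
exists A0; split => //; first by split=> //; right.
move=> x; apply: contrapT => nx.
have nx0 w a c : W w -> A0 a -> w = a + c *: x -> c = 0.
  move=> Ww Aa E; apply: contrapT => /eqP c0; apply: nx.
  exists (c^-1 *: w); split; first exact: subspaceZ.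
  rewrite E scalerDr scalerA mulVf // scale1r opprD addrCA subrr addr0.
  rewrite -scalerN -scaleN1r scalerA -[_ *: a]addr0.
  by apply: linA0 => //; right.
pose B : set V := [set y | exists a c, A0 a /\ y = a + c *: x].
apply: (maxA B); last first.
  split=> [b y z [a [c [Aa ->]]] [a' [c' [Aa' ->]]]|y [a [c [Aa yE]]] Wy].
    exists (b *: a + a'), (b * c + c'); split; first exact: linA0.
    by rewrite scalerDr scalerDl scalerA addrACA.
  have c0 := nx0 _ _ _ Wy Aa yE.
  by move: yE Wy; rewrite c0 scale0r addr0 => ->; exact: A0W.
rewrite properEneq; split; last first.
  by move=> a Aa; exists a, 0; split; [left|rewrite scale0r addr0].
apply/eqP => AB.
have Bx : B x by exists 0, 1; split; [right|rewrite scale1r add0r].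
apply: nx; exists 0; split; first exact: sW.1.
by rewrite subr0; left; rewrite AB.
Qed.

Lemma proj_exists : exists p : {linear V -> V},
  (forall x, W (p x)) /\ (forall x, W x -> p x = x).
Proof.
have [C [sC CW /choice[p hp]]] := complement_exists.
have p_uniq x w : W w -> C (x - w) -> p x = w.
  move=> Ww Cw; apply/eqP; rewrite -subr_eq0; apply/eqP; apply: CW.
    have -> : p x - w = (-1) *: (x - p x) + (x - w).
      by rewrite scaleN1r opprB addrA subrK.
    by apply: sC.2 => //; exact: (hp x).2.
  by apply: subspaceB => //; exact: (hp x).1.
have lin_p : linear p.
  move=> a x y; apply: p_uniq; first by apply: sW.2; exact: (hp _).1.
  have -> : a *: x + y - (a *: p x + p y) = a *: (x - p x) + (y - p y).
    by rewrite opprD addrACA scalerBr.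
  by apply: sC.2; exact: (hp _).2.
pose p' := HB.pack_for {linear V -> V} p (GRing.isLinear.Build k V V *:%R p lin_p).
exists p'; split=> x; first exact: (hp x).1.
by move=> Wx; apply: p_uniq; rewrite // subrr; exact: sC.1.
Qed.

End Projection.

Section Kernel.
Variables (k : fieldType) (V U N : lmodType k) (phi : {linear V -> U}).

Lemma subspace_ker : subspace [set v | phi v = 0]%classic.
Proof.
split=> [|a x y /= phix phiy]; first exact: linear0.
by rewrite linearP phix phiy scaler0 addr0.
Qed.

Lemma tmap_ker (t : V \ox N) : tmap phi idfun t = 0 ->
  exists s : seq (V * N),
    (forall p, p \in s -> phi p.1 = 0) /\ t = \sum_(p <- s) p.1 \ox p.2.
Proof.
have [p [Wp pW]] := proj_exists subspace_ker.
have sI : subspace [set u | exists v, phi v = u]%classic.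
  split; first by exists 0; exact: linear0.
  by move=> a _ _ [x <-] [y <-]; exists (a *: x + y); rewrite linearP.
have [q [Iq qI]] := proj_exists sI.
have /choice[g hg] := Iq.
pose s u := g u - p (g u).
have sE u v : phi v = q u -> s u = v - p v.
  move=> vu.
  have h : p (g u - v) = g u - v by apply: pW; rewrite /= linearB /= hg vu subrr.
  by rewrite /s -{1}[g u](subrK v) -h linearB /= addrAC [_ - p v]addrC addrK addrC.
have lin_s : linear s.
  move=> a x y; rewrite (@sE _ (a *: g x + g y)).
    by rewrite linearP /= /s opprD addrACA scalerBr.
  by rewrite !linearP /= !hg.
pose s' := HB.pack_for {linear U -> V} s (GRing.isLinear.Build k U V *:%R s lin_s).
have s_phi v : s' (phi v) = v - p v.
  by apply: sE; rewrite qI //; exists v.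
move=> t0.
have tE : t = tmap p idfun t.
  apply/eqP; rewrite -subr_eq0; apply/eqP.
  have -> : t - tmap p idfun t = tmap s' idfun (tmap phi idfun t).
    elim/tens_ind: {t0} t => [x y|x y IHx IHy].
      by rewrite !tmapE /= -[s _]/(s' (phi x)) s_phi tensDl -[- p x]scaleN1r tensZl scaleN1r.
    by rewrite !linearD /= -IHx -IHy addrACA.
  by rewrite t0 linear0.
exists [seq (p q.1, q.2) | q <- repr t]; split.
  by move=> _ /mapP[z _ ->]; exact: Wp.
rewrite {1}tE {1}(tens_sum t) linear_sum big_map /=.
by apply: eq_bigr => z _; rewrite tmapE.
Qed.

End Kernel.

Section Submodule.
Variables (k : fieldType) (G : alg_group k) (M : gmodule G) (W : gsubmodule M).

Definition gsub_pred : {pred M} := fun x => `[< gsub_set W x >].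

Lemma gsub_closed : GRing.submod_closed gsub_pred.
Proof.
have [W0 WD] := gsub_subspace W; split=> [|a x y /asboolP Wx /asboolP Wy].
  exact/asboolP.
by apply/asboolP; exact: WD.
Qed.

HB.instance Definition _ := GRing.isSubmodClosed.Build k M gsub_pred gsub_closed.

Definition gsub_type := {x : M | gsub_pred x}.
HB.instance Definition _ := SubChoice.on gsub_type.
HB.instance Definition _ := [SubChoice_isSubLmodule of gsub_type by <:].

Definition gsub_val : gsub_type -> M := \val.
HB.instance Definition _ := GRing.Linear.on gsub_val.

Lemma retract_exists : exists r : {linear M -> gsub_type},
  forall x, gsub_set W x -> \val (r x) = x.
Proof.
have [p [Wp pW]] := proj_exists (gsub_subspace W).
have Pp x : gsub_pred (p x) by apply/asboolP.
pose r x : gsub_type := Sub (p x) (Pp x).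
have lin_r : linear r.
  by move=> a x y; apply: val_inj; rewrite linearP /= linearP.
exists (HB.pack_for {linear M -> gsub_type} r
  (GRing.isLinear.Build k M gsub_type *:%R r lin_r)) => x Wx /=.
exact: pW.
Qed.

Definition retract : {linear M -> gsub_type} := sval (cid retract_exists).

Lemma retractK x : retract (gsub_val x) = x.
Proof.
apply: val_inj; apply: (svalP (cid retract_exists)).
by have /asboolP := valP x.
Qed.

(* gsub_coactE below characterizes this coaction: it does not depend on the
   choice of the linear retraction. *)
Definition gsub_coact : gsub_type -> gsub_type \ox coord G :=
  tmap retract idfun \o coact M \o gsub_val.
HB.instance Definition _ := GRing.Linear.on gsub_coact.

Lemma gsub_coactE w : tmap gsub_val idfun (gsub_coact w) = coact M (gsub_val w).
Proof.
have /asboolP/(@gsub_stable _ _ _ W)[s [sW wE]] := valP w.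
rewrite /gsub_coact /= tmap_comp [gsub_val w]/(\val w) wE linear_sum /=.
apply: eq_big_seq => p /sW Wp; rewrite tmapE /=.
by congr (_ \ox _); exact: (svalP (cid retract_exists)).
Qed.

Lemma tmap_gsub_inj (N : lmodType k) :
  injective (@tmap k gsub_type N M N gsub_val idfun).
Proof.
apply: (@can_inj _ _ _ (tmap retract idfun)) => t.
rewrite tmap_comp -[RHS]tmap_id; apply: tmap_eq => // x; exact: retractK.
Qed.

Lemma gsub_coactA w :
  tassoc (tmap gsub_coact idfun (gsub_coact w)) =
  tmap idfun (comul G) (gsub_coact w).
Proof.
apply: tmap_gsub_inj.
have -> : tmap gsub_val idfun (tassoc (tmap gsub_coact idfun (gsub_coact w))) =
    tassoc (tmap (tmap gsub_val idfun) idfun (tmap gsub_coact idfun (gsub_coact w))).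
  by rewrite tassoc_nat; apply: tmap_eq => x //; symmetry; exact: tmap_id.
have -> : tmap (tmap gsub_val idfun) idfun (tmap gsub_coact idfun (gsub_coact w)) =
    tmap (coact M) idfun (tmap gsub_val idfun (gsub_coact w)).
  by rewrite !tmap_comp; apply: tmap_eq => // x; exact: gsub_coactE.
rewrite gsub_coactE coactA -gsub_coactE !tmap_comp.
exact: tmap_eq.
Qed.

Lemma gsub_coact1 w : tcontr (counit G) (gsub_coact w) = w.
Proof.
apply: val_inj; rewrite -[LHS]/(gsub_val _) -[RHS]/(gsub_val w).
rewrite -[RHS](coact1 (gsub_val w)) -gsub_coactE.
elim/tens_ind: (gsub_coact w) => [x y|x y IHx IHy].
  by rewrite tmapE !tcontrE linearZ.
by rewrite !linearD /= IHx IHy.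
Qed.

Definition gsub_gmodule : gmodule G := GModule gsub_coactA gsub_coact1.

End Submodule.

Section Induction.
Variables (k : fieldType) (G : alg_group k) (H : closed_subgroup G).
Variable N : gmodule H.

(* N \ox k[G] with its H-action, whose invariants are the maps f such that
   f (g h) = h^-1 (f g), and with its G-action by left translations *)
Definition ind_H : gmodule H := tens_gmodule N (restr H (regr G)).
Definition ind_G : gmodule G := tens_gmodule (triv G N) (regl G).

Definition ind_set : set ind_G := invariants ind_H.

Definition ind_def : {linear (N \ox coord G)%type -> _} :=
  coact ind_H \- tensr 1.

Lemma ind_setE : ind_set = [set t | ind_def t = 0]%classic.
Proof.
apply/seteqP; split=> t /= h; first by rewrite /ind_def /= h subrr.
by move/eqP: h; rewrite subr_eq0 => /eqP.
Qed.

Lemma ind_subspace : subspace ind_set.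
Proof. by rewrite ind_setE; exact: subspace_ker. Qed.

Definition tensl (V U : lmodType k) (v : V) : U -> V \ox U := tens v.

Lemma tensl_linear (V U : lmodType k) (v : V) : linear (@tensl V U v).
Proof. by move=> a x y; rewrite /tensl tensDr tensZr. Qed.

HB.instance Definition _ (V U : lmodType k) (v : V) :=
  GRing.isLinear.Build k U (V \ox U)%type *:%R (@tensl V U v) (@tensl_linear V U v).

Lemma triv_tensE (V : lmodType k) (v : V) (w : coord G \ox coord G) :
  tmap idfun tprod (tmid (triv_coact G v \ox w)) = tassoci (v \ox w).
Proof.
elim/tens_ind: w => [x y|x y IHx IHy].
  by rewrite /triv_coact tensrE tmidE tmapE /= tprodE mul1r tassociE.
by rewrite !(tensDr, linearD) /= IHx IHy.
Qed.

Lemma ind_GE (n : N) a : coact ind_G (n \ox a) = tassoci (n \ox regl_coact a).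
Proof. by rewrite -triv_tensE; exact: tens_coactE. Qed.

Lemma ind_HE n a : coact ind_H (n \ox a) =
  tmap idfun tprod (tmid (coact N n \ox tmap idfun (cres H) (comul G a))).
Proof. exact: tens_coactE. Qed.

Lemma ind_comm t :
  tmap (coact ind_H) idfun (coact ind_G t) =
  tswapr (tmap (coact ind_G) idfun (coact ind_H t)).
Proof.
pose Phi (u : N \ox coord H) (z : coord G \ox (coord G \ox coord G)) :=
  tswap (tmap (antipode G)
    (tmap idfun tprod \o tmid \o tensl u \o tmap idfun (cres H)) z).
elim/tens_ind: t => [n a|x y IHx IHy]; last by rewrite !linearD /= IHx IHy.
have hl (w : coord G \ox coord G) :
    tmap (coact ind_H) idfun (tassoci (n \ox tswap (tmap (antipode G) idfun w))) =
    Phi (coact N n) (tmap idfun (comul G) w).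
  rewrite /Phi; elim/tens_ind: w => [x y|x y IHx IHy].
    by rewrite tmapE tswapE tassociE !tmapE /= tswapE tens_coactE.
  by rewrite !(tensDr, linearD) /= IHx IHy.
have hr u (w : coord G \ox coord G) :
    tswapr (tmap (coact ind_G) idfun
      (tmap idfun tprod (tmid (u \ox tmap idfun (cres H) w)))) =
    Phi u (tassoc (tmap (comul G) idfun w)).
  rewrite /Phi.
  elim/tens_ind: w => [x y|x y IHx IHy]; last by rewrite !(tensDr, linearD) /= IHx IHy.
  elim/tens_ind: u => [n0 n1|u u' IHu IHu'].
    rewrite !tmapE /= tmidE !tmapE /= tprodE tens_coactE /= triv_tensE /regl_coact /=.
    elim/tens_ind: (comul G x) => [x1 x2|s t IHs IHt].
      by rewrite tassocE !tmapE /= tswapE tassociE tswaprE tmapE /= /tensl tmidE tmapE /= tprodE tswapE.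
    by rewrite !(tensDl, tensDr, linearD) /= IHs IHt.
  rewrite !(tensDl, linearD) /= IHu IHu' -linearD /=; congr tswap.
  elim/tens_ind: (tassoc _) => [p z|s t IHs IHt].
    by rewrite !tmapE /= /tensl tensDl !linearD /= tensDr.
  by rewrite !linearD /= -IHs -IHt addrACA.
by rewrite ind_GE ind_HE hr comulA -hl.
Qed.

Lemma ind_stable : stable ind_set.
Proof.
move=> t; rewrite ind_setE => ft; apply: (tmap_ker (phi := ind_def)).
have e u : tmap ind_def idfun u =
    tmap (coact ind_H) idfun u - tmap (tensr 1) idfun u.
  elim/tens_ind: u => [x y|x y IHx IHy].
    by rewrite !tmapE /= tensDl -[- tensr _ _]scaleN1r tensZl scaleN1r.
  by rewrite !linearD /= IHx IHy addrACA.
have e1 u : tmap (tensr (1 : coord H)) idfun u = tswapr (u \ox 1).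
  elim/tens_ind: u => [x y|x y IHx IHy]; first by rewrite tmapE tswaprE.
  by rewrite !(tensDl, linearD) /= IHx IHy.
have -> : tmap ind_def idfun (coact ind_G t) =
    tswapr (tmap (coact ind_G) idfun (ind_def t)).
  rewrite e ind_comm e1 /ind_def /= !linearB /=.
  by congr (_ - tswapr _); rewrite tmapE.
by rewrite [ind_def t]ft !linear0.
Qed.

Definition ind : gmodule G := gsub_gmodule (GSubmodule ind_subspace ind_stable).

End Induction.

Section RelativeInjectivity.
Variables (k : fieldType) (G : alg_group k).

Definition ker (M N : gmodule G) (f : ghom M N) : set M :=
  [set m | f m = 0]%classic.

Definition image (M N : gmodule G) (f : ghom M N) : set N :=
  [set n | exists m, f m = n]%classic.

Definition zero_gmodule : gmodule G := triv G 'rV[k]_0.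

Definition zero_fun (M N : gmodule G) : M -> N := fun=> 0.

Lemma zero_fun_linear M N : linear (@zero_fun M N).
Proof. by move=> a x y; rewrite /zero_fun scaler0 addr0. Qed.

HB.instance Definition _ (M N : gmodule G) :=
  GRing.isLinear.Build k M N *:%R (@zero_fun M N) (@zero_fun_linear M N).

Lemma zero_funP M N m :
  coact N (@zero_fun M N m) = tmap (@zero_fun M N) idfun (coact M m).
Proof.
rewrite /zero_fun linear0; elim/tens_ind: (coact M m) => [x a|s t IHs IHt].
  by rewrite tmapE /= /zero_fun tens0l.
by rewrite linearD /= -IHs -IHt addr0.
Qed.

Definition zero_ghom (M N : gmodule G) : ghom M N := GHom (@zero_funP M N).

(* M is isomorphic to a submodule of I that has a complement *)
Definition is_direct_summand (M I : gmodule G) : Prop :=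
  exists i : ghom M I, injective i /\ direct_summand (image i).

Variable H : closed_subgroup G.

(* (G,H)-exactness at the middle term *)
Definition rel_exact_at (M' M M'' : gmodule G) (d' : ghom M' M) (d : ghom M M'') :
    Prop :=
  image d' = ker d /\ direct_summand (M := restr H M) (ker d).

Definition rel_short_exact (M1 M2 M3 : gmodule G)
    (d1 : ghom M1 M2) (d2 : ghom M2 M3) : Prop :=
  [/\ rel_exact_at (zero_ghom zero_gmodule M1) d1,
      rel_exact_at d1 d2 &
      rel_exact_at d2 (zero_ghom M3 zero_gmodule)].

Definition rel_injective (I : gmodule G) : Prop :=
  forall (M1 M2 M3 : gmodule G) (d1 : ghom M1 M2) (d2 : ghom M2 M3),
    rel_short_exact d1 d2 ->
    forall f : ghom M1 I, exists h : ghom M2 I, forall x, f x = h (d1 x).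

End RelativeInjectivity.

(* Main.v *)
(** The group law of G turns an H-homomorphism phi : M -> N into the
    G-homomorphism m |-> (g |-> phi (g^-1 m)), whose value at 1 is phi; this is
    Frobenius reciprocity for evaluation at 1.  Hence every ind N is relatively
    injective: transpose f : M1 -> ind N, extend the result to M2 through an
    H-retraction of M1 -> M2, and transpose back.  Conversely, evaluation at 1
    is an H-retraction of the unit M -> ind (res M), so the unit starts a
    (G,H)-exact sequence, and it splits over G if M is relatively injective. *)
Require Import Defs.
From HB Require Import structures.
From mathcomp Require Import all_boot all_algebra.
From mathcomp Require Import boolp classical_sets.

Set Implicit Arguments.
Unset Strict Implicit.
Unset Printing Implicit Defensive.

Import GRing.Theory Defs.
Local Open Scope ring_scope.

(** * Contraction and the involutive antipode *)

Lemma tcontr_nat (k : comNzRingType) (M M' N : lmodType k)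
    (e : {linear N -> k^o}) (f : {linear M -> M'}) t :
  f (tcontr e t) = tcontr e (tmap f idfun t).
Proof.
elim/tens_ind: t => [x a|x y IHx IHy]; first by rewrite tmapE !tcontrE linearZ.
by rewrite !linearD /= IHx IHy.
Qed.

Lemma antipodeK (k : fieldType) (G : alg_group k) :
  involutive (antipode G).
Proof.
(* For convolution, S o S and the identity are both inverse to S. *)
move=> a; pose S := antipode G.
(* [conv] is defined for maps into the tensor square only, so [coord G] is embedded there by
   [a |-> a \ox 1]. *)
pose j0 : {linear coord G -> (coord G \ox coord G)%type} := tensr (1 : coord G).
pose j1 : {linear coord G -> (coord G \ox coord G)%type} := j0 \o S.
pose j2 : {linear coord G -> (coord G \ox coord G)%type} := j1 \o S.
have mj (x y : coord G) : tmulm (j0 x \ox j0 y) = j0 (x * y).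
  by rewrite -/(tmul _ _) /= !tensrE tmulE mulr1.
have e1 b : conv j2 j1 b = conv_unit b.
  have h t : tmulm (tmap j2 j1 t) = j1 (tprod (tmap S idfun t)).
    elim/tens_ind: t => [x y|s t IHs IHt]; last by rewrite !linearD /= IHs IHt.
    by rewrite !tmapE /= tprodE rmorphM -mj.
  by rewrite convE h antipodel /= linearZ /= rmorph1 linearZ /= tensrE.
have e2 b : conv j1 j0 b = conv_unit b.
  have h t : tmulm (tmap j1 j0 t) = j0 (tprod (tmap S idfun t)).
    elim/tens_ind: t => [x y|s t IHs IHt]; last by rewrite !linearD /= IHs IHt.
    by rewrite !tmapE /= tprodE -mj.
  by rewrite convE h antipodel linearZ /= tensrE.
have e : j2 a = j0 a.
  rewrite -(convr1 j2) -(conv1r j0).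
  have -> : conv j2 (@conv_unit k G) a = conv j2 (conv j1 j0) a.
    by rewrite !convE; congr (tmulm _); apply: tmap_eq => // x; exact: esym (e2 x).
  rewrite -convA !convE; congr (tmulm _).
  by apply: tmap_eq => // x; exact: e1.
(* The counit on the second factor undoes the embedding. *)
have := congr1 (tcontr (counit G)) e.
by rewrite /= !tensrE !tcontrE rmorph1 !scale1r.
Qed.

(** * Direct summands and equivariant retractions *)

Section Splitting.
Variables (k : fieldType) (G : alg_group k).

Lemma subspace_image (V U : lmodType k) (f : {linear V -> U}) :
  subspace [set u | exists v, f v = u]%classic.
Proof.
split; first by exists 0; exact: linear0.
by move=> a _ _ [x <-] [y <-]; exists (a *: x + y); rewrite linearP.
Qed.

Lemma stable_image (M N : gmodule G) (f : ghom M N) : stable (image f).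
Proof.
move=> _ [m <-]; exists [seq (f p.1, p.2) | p <- repr (coact M m)]; split.
  by move=> _ /mapP[p _ ->]; exists p.1.
rewrite ghomP [in LHS](tens_sum (coact M m)) linear_sum big_map /=.
by apply: eq_bigr => p _; rewrite tmapE.
Qed.

(** Over a field, tensoring preserves kernels: whatever [tmap f idfun] kills is a sum of pure
    tensors with first factor in [ker f]. *)
Lemma stable_ker (M N : gmodule G) (f : ghom M N) : stable (ker f).
Proof.
by move=> m fm; apply: (tmap_ker (phi := f)); rewrite -ghomP [f m]fm linear0.
Qed.

(** Stability writes [coact M x] as a sum of pure tensors with first factor in [C], where [f]
    vanishes. *)
Lemma tmap_stable0 (M : gmodule G) (V : lmodType k) (C : gsubmodule M)
    (f : {linear M -> V}) : (forall x, gsub_set C x -> f x = 0) ->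
  forall x, gsub_set C x -> tmap f idfun (coact M x) = 0.
Proof.
move=> fC x /(@gsub_stable _ _ _ C)[s [sC ->]]; rewrite linear_sum /=.
by rewrite big_seq big1 // => p /sC /fC fp; rewrite tmapE /= fp tens0l.
Qed.

Lemma direct_summand_retract (M I : gmodule G) (i : ghom M I) (r : ghom I M) :
  cancel i r -> direct_summand (image i).
Proof.
move=> iK.
exists (GSubmodule (subspace_image i) (@stable_image _ _ i)).
exists (GSubmodule (subspace_ker r) (@stable_ker _ _ r)); split=> //.
  apply/seteqP; split=> [_ [[m <-] /= rim]|_ ->].
    by rewrite -[m]iK rim linear0.
  by split; [exists 0; exact: linear0|exact: linear0].
move=> x; exists (i (r x)), (x - i (r x)).
split; [by exists (r x)|by rewrite /= linearB /= iK subrr|].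
by rewrite addrC subrK.
Qed.

(** The retraction is the projection along the complement [C], read back through [i]. *)
Lemma retract_direct_summand (M I : gmodule G) (i : ghom M I) :
  injective i -> direct_summand (image i) -> exists r : ghom I M, cancel i r.
Proof.
move=> i_inj [U [C [UE UC0 UCT]]].
have /choice[r rP] x : exists m, gsub_set C (x - i m).
  have [u [c [Uu Cc ->]]] := UCT x.
  by move: Uu; rewrite UE => -[m <-]; exists m; rewrite addrC addKr.
have r_uniq x m : gsub_set C (x - i m) -> r x = m.
  move=> Cm; apply/i_inj/eqP; rewrite -subr_eq0; apply/eqP.
  have : (gsub_set U `&` gsub_set C)%classic (i (r x) - i m).
    split; first by rewrite UE; exists (r x - m); rewrite linearB.
    rewrite -(subrKA x) -[_ - x]opprB addrC.
    by apply: (subspaceB (gsub_subspace C)).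
  by rewrite UC0.
have r_lin : linear r.
  move=> a x y; apply: r_uniq; rewrite linearP opprD addrACA -scalerBr.
  exact: (gsub_subspace C).2.
pose r' := HB.pack_for {linear I -> M} r (GRing.isLinear.Build k I M *:%R r r_lin).
have r'i : r' \o i =1 idfun.
  by move=> m; apply: r_uniq; rewrite subrr; exact: (gsub_subspace C).1.
have r'C x : gsub_set C x -> r' x = 0.
  by move=> Cx; apply: r_uniq; rewrite linear0 subr0.
have r'P x : coact M (r' x) = tmap r' idfun (coact I x).
  (* Split [x] into its [C]-part, whose coaction [r'] kills by stability, and [i (r x)], where [i]
     is equivariant. *)
  rewrite -[x in RHS](subrK (i (r x))) 2!linearD /=.
  rewrite (tmap_stable0 r'C) // add0r ghomP tmap_comp.
  by rewrite (tmap_eq r'i (g' := idfun)) // tmap_id.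
by exists (GHom r'P) => m; exact: r'i.
Qed.

Lemma id_ghomP (M : gmodule G) m :
  coact M (idfun m) = tmap idfun idfun (coact M m).
Proof. by rewrite tmap_id. Qed.

Definition id_ghom (M : gmodule G) : ghom M M := GHom (@id_ghomP M).

Lemma comp_ghomP (M N P : gmodule G) (g : ghom N P) (f : ghom M N) m :
  coact P ((g \o f) m) = tmap (g \o f) idfun (coact M m).
Proof. by rewrite /= !ghomP tmap_comp. Qed.

Definition comp_ghom (M N P : gmodule G) (g : ghom N P) (f : ghom M N) :
  ghom M P := GHom (comp_ghomP g f).

(** With [direct_summandT], this settles exactness at the two outer terms of a short exact
    sequence. *)
Lemma direct_summand0 (M : gmodule G) : direct_summand [set (0 : M)]%classic.
Proof.
have -> : [set (0 : M)]%classic = image (zero_ghom (zero_gmodule G) M).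
  by apply/seteqP; split=> [_ ->|_ [m <-]] //; exists 0.
apply: (@direct_summand_retract _ _ _ (zero_ghom M _)) => m.
exact/esym/thinmx0.
Qed.

Lemma direct_summandT (M : gmodule G) : direct_summand (@setT M).
Proof.
have -> : setT = image (id_ghom M).
  by apply/seteqP; split=> // m _; exists m.
exact: (@direct_summand_retract _ _ _ (id_ghom M)).
Qed.

End Splitting.

(** * Restriction of homomorphisms to the subgroup *)

Section Restriction.
Variables (k : fieldType) (G : alg_group k) (H : closed_subgroup G).

Lemma restr_ghomP (M N : gmodule G) (f : ghom M N) m :
  coact (restr H N) (f m) = tmap f idfun (coact (restr H M) m).
Proof. by rewrite /= /restr_coact /= ghomP !tmap_comp; apply: tmap_eq. Qed.

Definition restr_ghom (M N : gmodule G) (f : ghom M N) :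
  ghom (restr H M) (restr H N) :=
  @GHom _ _ (restr H M) (restr H N) f (restr_ghomP f).

End Restriction.

(** * Quotient modules *)

Section Quotient.
Variables (k : fieldType) (G : alg_group k) (M : gmodule G) (W : gsubmodule M).

Lemma stable_triv (V : lmodType k) (C : set V) : stable (M := triv G V) C.
Proof.
move=> w Cw; exists [:: (w, 1)]; split; last by rewrite big_seq1.
by move=> p; rewrite inE => /eqP->.
Qed.

(* The quotient is carried by a linear complement of W; declaring that
   complement a submodule for the trivial action makes it an lmodType. *)
Lemma quotient_exists : exists (Q : gmodule G) (d : ghom M Q),
  (forall q, exists m, d m = q) /\ ker d = gsub_set W.
Proof.
have [p [Wp pW]] := proj_exists (gsub_subspace W).
pose C := @GSubmodule k G (triv G M) _ (subspace_ker p) (@stable_triv M _).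
pose Q := gsub_type C.
pose s : {linear Q -> M} := @gsub_val _ _ _ _.
have dP (x : M) : gsub_pred C (x - p x).
  by apply/asboolP; rewrite /= linearB /= (pW (p x)) // subrr.
pose d x : Q := Sub (x - p x) (dP x).
have sd x : s (d x) = x - p x by [].
have s_inj : injective s by exact: val_inj.
have d_lin : linear d.
  move=> a x y; apply: s_inj; rewrite linearP !sd linearP /= opprD.
  by rewrite scalerBr addrACA.
pose d' := HB.pack_for {linear M -> Q} d (GRing.isLinear.Build k M Q *:%R d d_lin).
have ds : cancel s d'.
  by move=> q; apply: s_inj; rewrite [LHS]sd; have /asboolP /= -> := valP q; rewrite subr0.
have dW x : gsub_set W x -> d' x = 0.
  by move=> Wx; apply: s_inj; rewrite [LHS]sd pW // subrr linear0.
pose c : {linear Q -> (Q \ox coord G)%type} := tmap d' idfun \o coact M \o s.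
(* The coaction does not depend on the representative: [x] and [s (d' x)] differ by [p x] in [W],
   and stability of [W] makes [d'] kill its coaction. *)
have cE x : c (d' x) = tmap d' idfun (coact M x).
  rewrite /c /= [s (d x)]sd linearB /= linearB /=.
  by rewrite (tmap_stable0 dW (Wp x)) subr0.
have cA q : tassoc (tmap c idfun (c q)) = tmap idfun (comul G) (c q).
  rewrite -[q]ds cE tmap_comp.
  have -> : tmap (c \o d') (idfun \o idfun) (coact M (s q)) =
      tmap (tmap d' idfun) idfun (tmap (coact M) idfun (coact M (s q))).
    by rewrite tmap_comp; apply: tmap_eq => // x; exact: cE.
  by rewrite tassoc_nat coactA !tmap_comp; apply: tmap_eq => x //=; rewrite tmap_id.
have c1 q : tcontr (counit G) (c q) = q.
  by rewrite -[q in RHS]ds -[s q in RHS]coact1 tcontr_nat.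
exists (GModule cA c1), (@GHom _ _ M (GModule cA c1) d' cE); split.
  by move=> q; exists (s q); exact: ds.
apply/seteqP; split=> x /=; last exact: dW.
move/(congr1 s); rewrite [LHS]sd linear0 => /subr0_eq ->; exact: Wp.
Qed.

End Quotient.

(** * Frobenius reciprocity for evaluation at 1 *)

Section Frobenius.
Variables (k : fieldType) (G : alg_group k) (H : closed_subgroup G).
Variable N : gmodule H.
Local Notation A := (coord G).
Local Notation S := (antipode G).

Definition ev1 : {linear (N \ox A)%type -> N} := tcontr (counit G).

(** For a function [f] this is [(g f)(1) = f (g^-1)]. *)
Lemma ev1_coact (t : N \ox A) :
  tmap ev1 idfun (coact (ind_G N) t) = tmap idfun S t.
Proof.
elim/tens_ind: t => [n a|s t IHs IHt]; last by rewrite !linearD /= IHs IHt.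
rewrite ind_GE tmapE /= -[a in RHS]counitr /regl_coact /=.
elim/tens_ind: (comul G a) => [x y|s t IHs IHt].
  by rewrite tmapE tswapE tassociE tmapE /= !tcontrE linearZ /= tensZl tensZr.
by rewrite !(tensDr, linearD) /= IHs IHt.
Qed.

(* The invariance of t reads f(gh) = h^-1 f(g); applying
   n \ox a \ox b |-> n \ox cres (S a) b to it gives f(h^-1) = h f(1). *)
Lemma ev1_invariant (t : ind_G N) : ind_set t ->
  coact N (ev1 t) = tmap idfun (cres H \o S) t.
Proof.
have [K KE] : exists K : {linear ((N \ox A) \ox coord H)%type -> (N \ox coord H)%type},
    forall n a b, K ((n \ox a) \ox b) = n \ox (cres H (S a) * b).
  exists (tmap idfun (tprod \o tmap (cres H \o S) idfun) \o tassoc) => n a b.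
  by rewrite /= tassocE tmapE /= tmapE tprodE.
move=> /(congr1 K) e.
have -> : tmap idfun (cres H \o S) t = K (t \ox 1).
  elim/tens_ind: {e} t => [n a|x y IHx IHy]; first by rewrite KE mulr1 tmapE.
  by rewrite tensDl !linearD /= IHx IHy.
rewrite -e.
elim/tens_ind: {e} t => [n a|x y IHx IHy]; last by rewrite !linearD /= IHx IHy.
rewrite ind_HE /ev1 /= tcontrE linearZ /=.
(* [K] brings [S a1] next to [a2], so for [w = comul G a] the antipode axiom reduces their product
   to the counit. *)
have h u w : K (tmap idfun tprod (tmid (u \ox tmap idfun (cres H) w))) =
    tmap idfun (cres H (tprod (tmap S idfun w)) \*o idfun) u.
  elim/tens_ind: w => [a1 a2|x y IHx IHy].
    elim/tens_ind: u => [n0 b|x y IHx IHy].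
      rewrite !tmapE /= tmidE tmapE /= !tprodE KE rmorphM /=.
      by rewrite [b * _]mulrC mulrA.
    by rewrite !(tensDl, linearD) /= IHx IHy.
  rewrite !(tensDr, linearD) /= IHx IHy.
  elim/tens_ind: u {IHx IHy} => [n0 b|u v IHu IHv].
    by rewrite !tmapE /= mulrDl tensDr.
  by rewrite !linearD /= -IHu -IHv addrACA.
rewrite h antipodel linearZ /= rmorph1.
elim/tens_ind: (coact N n) => [n0 b|u v IHu IHv].
  by rewrite tmapE /= -scalerAl mul1r tensZr.
by rewrite !linearD /= IHu IHv.
Qed.

Definition ind_sub : gsubmodule (ind_G N) :=
  GSubmodule (ind_subspace N) (@ind_stable _ _ _ N).

Definition ind_val : {linear ind N -> ind_G N} := @gsub_val _ _ _ ind_sub.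

Definition ind_ev : {linear ind N -> N} := ev1 \o ind_val.

Lemma ind_ev_coact (t : ind N) :
  tmap ind_ev idfun (coact (ind N) t) = tmap idfun S (ind_val t).
Proof. by rewrite -ev1_coact -gsub_coactE [RHS]tmap_comp; apply: tmap_eq. Qed.

(** Both sides are [h |-> f (h^-1)]: the left one by invariance of [f], the right one by the left
    translation action. *)
Lemma ind_ev_ghomP (t : ind N) :
  coact N (ind_ev t) = tmap ind_ev idfun (coact (restr H (ind N)) t).
Proof.
have /asboolP tP := valP t.
have -> : coact N (ind_ev t) = tmap idfun (cres H \o S) (ind_val t).
  exact: ev1_invariant.
have -> : tmap ind_ev idfun (coact (restr H (ind N)) t) =
    tmap idfun (cres H) (tmap ind_ev idfun (coact (ind N) t)).
  by rewrite /= /restr_coact /= !tmap_comp; apply: tmap_eq.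
by rewrite ind_ev_coact tmap_comp; apply: tmap_eq.
Qed.

Definition ind_ev_ghom : ghom (restr H (ind N)) N :=
  @GHom _ _ (restr H (ind N)) N ind_ev ind_ev_ghomP.

(** Uniqueness in Frobenius reciprocity: evaluating the translates of [f] at 1 gives
    [g |-> f (g^-1)], which determines [f] because the antipode is an involution. *)
Lemma ghom_ind_eq (M : gmodule G) (f g : ghom M (ind N)) :
  (forall m, ind_ev (f m) = ind_ev (g m)) -> f =1 g.
Proof.
move=> fg m; apply: val_inj.
have Sinj : injective (@tmap _ N A N A idfun S).
  apply: (can_inj (g := tmap idfun S)) => t.
  rewrite tmap_comp -[RHS]tmap_id; apply: tmap_eq => // a; exact: antipodeK.
apply: Sinj; rewrite -[LHS]ind_ev_coact -[RHS]ind_ev_coact !ghomP !tmap_comp.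
exact: tmap_eq.
Qed.

Section Lift.
Variables (M : gmodule G) (phi : ghom (restr H M) N).

(* phi (g^-1 m) as a function of g *)
Definition lift_fun : {linear M -> ind_G N} :=
  tmap (phi : {linear M -> N}) S \o coact M.

(** Inversion carries the right regular representation to the left one. *)
Lemma regl_antipode a : regl_coact (S a) = tmap S idfun (comul G a).
Proof.
rewrite /regl_coact /= comul_antipode.
elim/tens_ind: (comul G a) => [x y|s t IHs IHt]; last by rewrite !linearD /= IHs IHt.
by rewrite !tmapE tswapE tmapE tswapE /= antipodeK.
Qed.

Lemma lift_fun_coact m :
  coact (ind_G N) (lift_fun m) = tmap lift_fun idfun (coact M m).
Proof.
have h t : coact (ind_G N) (tmap (phi : {linear M -> N}) S t) =
    tassoci (tmap (phi : {linear M -> N}) (tmap S idfun) (tmap idfun (comul G) t)).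
  elim/tens_ind: t => [x a|s t IHs IHt]; last by rewrite !linearD /= IHs IHt.
  by rewrite tmapE ind_GE regl_antipode !tmapE.
rewrite [LHS]h -coactA -tassoc_nat tassocK tmap_comp; exact: tmap_eq.
Qed.

(** Equivariance of [phi] gives [h phi ((g h)^-1 m) = phi (h h^-1 g^-1 m)], and [h h^-1] cancels. *)
Lemma lift_fun_invariant m : ind_set (lift_fun m).
Proof.
pose L : {linear ((M \ox A) \ox (A \ox A))%type -> ((N \ox A) \ox coord H)%type} :=
  tmap idfun tprod \o tmid \o tmap (tmap (phi : {linear M -> N}) (cres H))
    (tmap idfun (cres H) \o tswap \o tmap S S).
have LE x p q r : L ((x \ox p) \ox (q \ox r)) =
    (phi x \ox S r) \ox (cres H (p * S q)).
  by rewrite /L /= !tmapE /= !tmapE /= tswapE tmapE tmidE tmapE /= tprodE rmorphM.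
have phiP x : coact N (phi x) =
    tmap (phi : {linear M -> N}) idfun (tmap idfun (cres H) (coact M x)).
  exact: (ghomP phi x).
have indL t : coact (ind_H N) (tmap (phi : {linear M -> N}) S t) =
    L (tmap (coact M) (comul G) t).
  elim/tens_ind: t => [x a|s t IHs IHt]; last by rewrite !linearD /= IHs IHt.
  rewrite tmapE ind_HE phiP comul_antipode tmap_comp /L /= [in RHS]tmapE /=.
  by rewrite [in RHS]tmapE; congr (tmap _ _ (tmid (_ \ox _))); apply: tmap_eq.
(* [T x] sends [p \ox (q \ox r)] to the value of [L] on [(x \ox p) \ox (q \ox r)]; having all three
   factors together allows them to be regrouped. *)
pose T x : {linear (A \ox (A \ox A))%type -> ((N \ox A) \ox coord H)%type} :=
  tmap (tensl (phi x) \o S) (cres H) \o tswap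
    \o tmap (tprod \o tmap idfun S) idfun \o tassoci.
have LT x w : L (tmap idfun (comul G) (tassoci (x \ox w))) =
    T x (tmap idfun (comul G) w).
  elim/tens_ind: w => [p z|s t IHs IHt]; last by rewrite !(tensDr, linearD) IHs IHt.
  rewrite tassociE !tmapE; elim/tens_ind: (comul G z) => [q r|s t IHs IHt].
    by rewrite LE /T /= tassociE tmapE /= tmapE tprodE tswapE tmapE.
  by rewrite !(tensDr, linearD) IHs IHt.
(* In this grouping [p] and [q] come from one coproduct, so [p * S q] collapses to the counit; this
   is the cancellation of [h h^-1]. *)
have TE x w : T x (tassoc (tmap (comul G) idfun w)) =
    (phi x \ox S (tcontr (counit G) (tswap w))) \ox 1.
  elim/tens_ind: w => [y z|s t IHs IHt].
    rewrite /T /= tassocK !tmapE /= antipoder tswapE tmapE linearZ /= rmorph1.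
    by rewrite tswapE tcontrE linearZ /= tensZr tensZr tensZl.
  by rewrite !(tensDr, tensDl, linearD) IHs IHt.
have LS t : L (tmap idfun (comul G) (tassoci (tmap idfun (comul G) t))) =
    tmap (phi : {linear M -> N}) S t \ox 1.
  elim/tens_ind: t => [x b|s t IHs IHt]; last by rewrite !(tensDl, linearD) IHs IHt.
  by rewrite tmapE LT -comulA TE counitl tmapE.
rewrite /ind_set /invariants /= -LS -coactA tassocK tmap_comp; exact: indL.
Qed.

Lemma lift_pred m : gsub_pred ind_sub (lift_fun m).
Proof. by apply/asboolP; exact: lift_fun_invariant. Qed.

Definition lift (m : M) : ind N := Sub (lift_fun m) (lift_pred m).

Lemma ind_val_lift m : ind_val (lift m) = lift_fun m.
Proof. by []. Qed.

Lemma lift_linear : linear lift.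
Proof.
by move=> a x y; apply: val_inj; rewrite /= -!/(gsub_val _) !linearP.
Qed.

HB.instance Definition _ := GRing.isLinear.Build k M (ind N) *:%R lift lift_linear.

Lemma lift_ghomP m : coact (ind N) (lift m) = tmap lift idfun (coact M m).
Proof.
apply: tmap_gsub_inj; rewrite gsub_coactE ind_val_lift lift_fun_coact tmap_comp.
exact: tmap_eq.
Qed.

Definition lift_ghom : ghom M (ind N) := GHom lift_ghomP.

Lemma ind_ev_lift m : ind_ev (lift m) = phi m.
Proof.
rewrite /ind_ev /= ind_val_lift /lift_fun /= -[m in RHS]coact1.
elim/tens_ind: (coact M m) => [x a|s t IHs IHt]; last by rewrite !linearD /= IHs IHt.
by rewrite tmapE /ev1 /= !tcontrE /= antipode_counit linearZ.
Qed.

End Lift.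

End Frobenius.

(** * Relative injectivity of induced modules, and splitting *)

Section RelativelyInjective.
Variables (k : fieldType) (G : alg_group k) (H : closed_subgroup G).

Lemma rel_injective_ind (N : gmodule H) : rel_injective H (ind N).
Proof.
move=> M1 M2 M3 d1 d2 [[ker1 _] [im1 split1] _] f.
have d1_inj : injective d1.
  apply: raddf_inj => x d1x; have : ker d1 x by [].
  by rewrite -ker1 => -[y <-].
have [r rK] : exists r : ghom (restr H M2) (restr H M1), cancel d1 r.
  apply: (@retract_direct_summand _ _ _ _ (restr_ghom H d1)) => //.
  by rewrite -im1 in split1.
exists (lift_ghom (comp_ghom (ind_ev_ghom N) (comp_ghom (restr_ghom H f) r))).
(* By uniqueness it suffices to compare after evaluation at 1, where [r] cancels [d1]. *)
apply: (ghom_ind_eq (g := comp_ghom (lift_ghom _) d1)) => x.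
by rewrite [RHS]ind_ev_lift /= rK.
Qed.

Lemma rel_injective_retract (M I : gmodule G) (i : ghom M I) (r : ghom I M) :
  cancel i r -> rel_injective H I -> rel_injective H M.
Proof.
move=> iK injI M1 M2 M3 d1 d2 ex f.
have [h hP] := injI _ _ _ _ _ ex (comp_ghom i f).
by exists (comp_ghom r h) => x; rewrite /= -hP /= iK.
Qed.

(** Dividing [I] by the image of [i] yields a short exact sequence, which [r] makes relatively
    exact; injectivity then extends the identity of [M] along [i]. *)
Lemma rel_injective_split (M I : gmodule G) (i : ghom M I)
    (r : ghom (restr H I) (restr H M)) :
  cancel i r -> rel_injective H M -> exists r' : ghom I M, cancel i r'.
Proof.
move=> iK injM.
have [Q [d [d_surj kerd]]] :=
  quotient_exists (GSubmodule (subspace_image i) (@stable_image _ _ _ _ i)).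
have [] // := injM _ _ _ i d _ (id_ghom M); last by move=> h hP; exists h => x; rewrite -hP.
have ker_i : ker i = [set 0]%classic.
  apply/seteqP; split=> [x /= ix|_ ->]; last exact: linear0.
  by rewrite -[x]iK ix; exact: linear0.
split.
- split; last by rewrite ker_i; exact: direct_summand0.
  by rewrite ker_i; apply/seteqP; split=> [_ [x <-]|_ ->] //; exists 0.
- split; first by rewrite kerd.
  by rewrite kerd; exact: (@direct_summand_retract _ _ _ _ (restr_ghom H i) r).
- have kerT : ker (zero_ghom Q (zero_gmodule G)) = setT by apply/seteqP.
  split; last by rewrite kerT; exact: direct_summandT.
  by rewrite kerT; apply/seteqP; split=> // q _; exact: d_surj.
Qed.

End RelativelyInjective.

Theorem lemma3p3p1 (k : fieldType) (G : alg_group k) (H : closed_subgroup G)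
    (M : gmodule G) :
  rel_injective H M <->
  exists N : gmodule H, is_direct_summand M (ind N).
Proof.
split=> [injM|[N [i [i_inj i_summand]]]].
  exists (restr H M); pose i := lift_ghom (id_ghom (restr H M)).
  have iK : cancel i (ind_ev_ghom (restr H M)).
    by move=> m; exact: (ind_ev_lift (id_ghom (restr H M)) m).
  have [r rK] := rel_injective_split iK injM.
  by exists i; split; [exact: can_inj rK|exact: direct_summand_retract rK].
have [r rK] := retract_direct_summand i_inj i_summand.
exact: rel_injective_retract rK (@rel_injective_ind _ _ _ N).
Qed.
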